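(* Let $a<b$ be real numbers, let $(X_t)_{t=1}^\infty$ be adapted to a filtration $(\mathcal F_t)$ with $X_t\in[a,b]$ a.s. for all $t$, and let $(\widehat X_t)_{t=1}^\infty$ be any $[a,b]$-valued predictable sequence. Let $\overline X_t=t^{-1}\sum_{i=1}^t X_i$ and $\mu_t=t^{-1}\sum_{i=1}^t\mathbb{E}[X_i\mid\mathcal F_{i-1}]$. Let $\alpha\in(0,1)$ and let $u$ be any sub-exponential uniform boundary with crossing probability $\alpha$ for scale $c=b-a$. Then $$\mathbb{P}\left(\forall t\ge 1:\ \left|\overline X_t-\mu_t\right|<\frac{u\left(\sum_{i=1}^t(X_i-\widehat X_i)^2\right)}{t}\right)\ge 1-2\alpha.$$
   Context: The filtration is $(\mathcal F_t)_{t=0}^\infty$; predictable means $\widehat X_t$ is $\mathcal F_{t-1}$-measurable for each $t\ge1$. Sub-$\psi$ condition: let $(S_t)_{t=0}^\infty$, $(V_t)_{t=0}^\infty$ be real-valued processes adapted to a filtration $(\mathcal F_t)_{t=0}^\infty$ with $S_0=V_0=0$ and $V_t\ge 0$ for all $t$. For $\psi:[0,\lambda_{\max})\to\mathbb{R}$ and $l_0\in[1,\infty)$, $(S_t)$ is $l_0$-sub-$\psi$ with variance process $(V_t)$ if for each $\lambda\in[0,\lambda_{\max})$ there is a supermartingale $(L_t(\lambda))_{t=0}^\infty$ with respect to $(\mathcal F_t)$ with $\mathbb{E}L_0(\lambda)\le l_0$ and $\exp\{\lambda S_t-\psi(\lambda)V_t\}\le L_t(\lambda)$ a.s. for all $t$.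 Uniform boundary: $u$ is an $l_0$-sub-$\psi$ uniform boundary with crossing probability $\alpha$ if $\mathbb{P}(\exists t\ge 1: S_t\ge u(V_t))\le\alpha$ for every pair $(S_t,V_t)$ such that $(S_t)$ is $l_0$-sub-$\psi$ with variance process $(V_t)$. A sub-exponential uniform boundary for scale $c>0$ is an $l_0$-sub-$\psi$ uniform boundary with $\psi(\lambda)=\psi_{E,c}(\lambda)=c^{-2}(-\log(1-c\lambda)-c\lambda)$ on $0\le\lambda<1/c$; here, the process being scalar, $l_0=1$. *)

(* Defs.v *)
From HB Require Import structures.
From mathcomp Require Import all_boot all_order all_algebra.
From mathcomp Require Import all_classical all_reals all_analysis.

Set Implicit Arguments.
Unset Strict Implicit.
Unset Printing Implicit Defensive.
Import Order.TTheory GRing.Theory Num.Theory.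
Import numFieldNormedType.Exports.

Local Open Scope classical_set_scope.
Local Open Scope ring_scope.

Section probability_space.
Context {d : measure_display} {T : measurableType d} {R : realType}.
Variable P : probability T R.

(* A probability is only specified on measurable sets, while a boundary [u] is
   an arbitrary real function, so that the events it defines need not be
   measurable.  Probabilities of such events are therefore bounded from above
   by the outer probability and from below by the inner one; both agree with
   [P] on measurable sets, as shown below. *)
Definition outer_probability (E : set T) : \bar R := mu_ext P E.

Definition inner_probability (E : set T) : \bar R :=
  (1 - outer_probability (~` E))%E.

Lemma outer_probabilityE (E : set T) : measurable E ->
  outer_probability E = P E.
Proof. by move=> mE; rewrite /outer_probability measurable_mu_extE. Qed.

Lemma inner_probabilityE (E : set T) : measurable E ->
  inner_probability E = P E.
Proof.
move=> mE; rewrite /inner_probability outer_probabilityE; last exact: measurableC.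
by rewrite -probability_setC ?setCK//; exact: measurableC.
Qed.

(* Meant for [G] a sigma-algebra on [T], in which case [G] is the set of
   measurable sets of [g_sigma_algebraType G]. *)
Definition measurable_wrt (G : set (set T)) (f : T -> R) : Prop :=
  measurable_fun [set: g_sigma_algebraType G] (f : g_sigma_algebraType G -> R).

Definition filtration (F : nat -> set (set T)) : Prop :=
  [/\ forall t, sigma_algebra [set: T] (F t),
      forall t, F t `<=` measurable &
      forall s t, (s <= t)%N -> F s `<=` F t].

Definition adapted (F : nat -> set (set T)) (X : nat -> T -> R) : Prop :=
  forall t, measurable_wrt (F t) (X t).

(* [Y] is a version of the conditional expectation E[X | G]. *)
Definition is_cond_expectation (G : set (set T)) (X Y : T -> R) : Prop :=
  [/\ measurable_wrt G Y,
      P.-integrable [set: T] (EFin \o Y) &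
      forall A, G A ->
        (\int[P]_(w in A) (Y w)%:E = \int[P]_(w in A) (X w)%:E)%E].

Definition supermartingale (F : nat -> set (set T)) (L : nat -> T -> R) : Prop :=
  [/\ adapted F L,
      forall t, P.-integrable [set: T] (EFin \o L t) &
      forall t, exists2 Y : T -> R, is_cond_expectation (F t) (L t.+1) Y &
        {ae P, forall w, Y w <= L t w}].

Definition sub_psi (l0 : R) (lmax : \bar R) (psi : R -> R)
    (F : nat -> set (set T)) (S V : nat -> T -> R) : Prop :=
  [/\ adapted F S,
      adapted F V,
      forall w, S 0%N w = 0 /\ V 0%N w = 0,
      forall t w, 0 <= V t w &
      forall lam : R, 0 <= lam -> (lam%:E < lmax)%E ->
        exists L : nat -> T -> R,
          [/\ supermartingale F L,
              ('E_P[L 0%N] <= l0%:E)%E &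
              forall t, {ae P, forall w,
                expR (lam * S t w - psi lam * V t w) <= L t w}]].

End probability_space.

(* Being a boundary is a property of [u] alone: the bound is required on every
   filtered probability space.  Only the values of [u] on [0, +oo[ matter. *)
Definition sub_psi_uniform_boundary {R : realType} (l0 : R) (lmax : \bar R)
    (psi : R -> R) (alpha : R) (u : R -> R) : Prop :=
  forall (d : measure_display) (T : measurableType d) (P : probability T R)
    (F : nat -> set (set T)) (S V : nat -> T -> R),
    filtration F -> sub_psi P l0 lmax psi F S V ->
    (outer_probability P
       [set w | exists2 t, (1 <= t)%N & (u (V t w) <= S t w)%R] <= alpha%:E)%E.

Definition psiE {R : realType} (c lam : R) : R :=
  (c ^+ 2)^-1 * (- ln (1 - c * lam) - c * lam).

Definition sub_exponential_uniform_boundary {R : realType} (c alpha : R)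
    (u : R -> R) : Prop :=
  sub_psi_uniform_boundary 1 (c^-1)%:E (psiE c) alpha u.

(* Sequences (X_t) with t >= 1 are indexed by nat with entry 0 unused. *)
Definition running_mean {R : realType} {T : Type} (X : nat -> T -> R) (t : nat)
    (w : T) : R :=
  t%:R^-1 * \sum_(1 <= i < t.+1) X i w.

(* Main.v *)
Require Import Defs.
From HB Require Import structures.
From mathcomp Require Import all_boot all_order all_algebra.
From mathcomp Require Import all_classical all_reals all_analysis.
From mathcomp Require Import finmap measurable_realfun ring lra.

Set Implicit Arguments.
Unset Strict Implicit.
Unset Printing Implicit Defensive.
Import Order.TTheory GRing.Theory Num.Theory.
Import numFieldNormedType.Exports.
Import HBNNSimple.

Local Open Scope classical_set_scope.
Local Open Scope ring_scope.

(* With xi_i = X_i - Xhat_i >= -(b - a), Fan's inequality (fan_le) bounds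
   exp (l xi_i - psi(l) xi_i^2) by 1 + l xi_i, an affine function of X_i whose
   conditional mean 1 + l (m_i - Xhat_i), with m_i = E[X_i | F_(i-1)], is at
   most exp (l (m_i - Xhat_i)).  Hence the product of the
   (1 + l xi_i) exp (- l (m_i - Xhat_i)) is a supermartingale dominating
   exp (l S_t - psi(l) V_t), where S_t = sum (X_i - m_i) and V_t = sum xi_i^2.
   The theorem is the union bound over X and -X, which share the same V.

   Versions of conditional expectations are only a.e. bounded, so the
   supermartingale is built from X and m clamped to [a, b]; S and V are not. *)

(** * Fan's scalar inequality *)

Lemma fan_le (R : realType) (l x : R) : 0 <= l < 1 -> -1 <= x ->
  expR (l * x - (- ln (1 - l) - l) * x ^+ 2) <= 1 + l * x.
Proof.
move=> /andP[l0 l1] x1.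
(* In terms of l, the logarithm of the ratio of both sides is nondecreasing and
   vanishes at 0. *)
pose D (s : R) := ln (1 + s * x) - s * x - x ^+ 2 * (ln (1 - s) + s).
have pos1 (s : R) : 0 <= s -> s < 1 -> 0 < 1 - s by move=> *; lra.
have pos2 (s : R) : 0 <= s -> s < 1 -> 0 < 1 + s * x by move=> *; nra.
have dD (s : R) : 0 <= s -> s < 1 -> is_derive s 1 D
   (x ^+ 2 * s * ((1 - s)^-1 - (1 + s * x)^-1)).
  move=> s0 s1.
  have p1 := pos1 _ s0 s1; have p2 := pos2 _ s0 s1.
  have d1 : is_derive s (1:R) (fun s : R => ln (1 + s * x))
      ((1 + s * x)^-1 * x).
    have := @is_derive1_comp R (@ln R) (fun s : R => 1 + s * x) s _ _
      (is_derive1_ln p2).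
    apply; apply: is_derive_eq.
    by rewrite !scaler0 ?add0r ?addr0 /GRing.scale/=; ring.
  have d2 : is_derive s (1:R) (fun s : R => ln (1 - s)) (- (1 - s)^-1).
    have -> : - (1 - s)^-1 = (1 - s)^-1 * (0 - 1) by ring.
    have := @is_derive1_comp R (@ln R) (fun s : R => 1 - s) s _ _
      (is_derive1_ln p1).
    by apply.
  rewrite /D; apply: is_derive_eq; rewrite /GRing.scale/=.
  by field; rewrite !gt_eqF.
suff : D 0 <= D l.
  rewrite /D !(mul0r, addr0, subr0, ln1, mulr0) => D0.
  rewrite -[leRHS]lnK ?posrE ?pos2// ler_expR.
  move: (ln _) (ln _) D0 => p q D0; lra.
have h0 : {in `[0, l], forall s, derivable D s 1}.
  move=> s; rewrite in_itv/= => /andP[s0 sl].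
  by have [] := dD s s0 (le_lt_trans sl l1).
apply: (@ger0_derive1_ndecr _ D 0 l) => //.
- by move=> s sl; apply: h0; exact: subset_itv_oo_cc sl.
- move=> s; rewrite in_itv/= => /andP[s0 sl].
  have s1 := lt_trans sl l1.
  rewrite derive1E (@derive_val _ _ _ _ _ _ _ (dD s (ltW s0) s1)).
  apply: mulr_ge0; first by rewrite mulr_ge0 ?sqr_ge0 ?ltW.
  (* The bracket is nonnegative because [x >= -1] gives [1 - s <= 1 + s * x], both sides being
     positive. *)
  rewrite subr_ge0 lef_pV2 ?posrE; last 2 first.
  - by apply: pos2 => //; exact: ltW.
  - by apply: pos1 => //; exact: ltW.
  nra.
- exact: derivable_within_continuous.
Qed.

(** * Measurability and conditional expectations *)

Lemma measurable_wrt_sub (d : measure_display) (T : measurableType d)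
    (R : realType) (G H : set (set T)) (f : T -> R) :
  sigma_algebra setT G -> sigma_algebra setT H -> G `<=` H ->
  measurable_wrt G f -> measurable_wrt H f.
Proof.
move=> sG sH GH mf _ B mB.
have := mf measurableT B mB.
rewrite /measurable/= !sigma_algebra_id//; exact: GH.
Qed.

Lemma measurable_wrtW (d : measure_display) (T : measurableType d)
    (R : realType) (G : set (set T)) (f : T -> R) :
  sigma_algebra setT G -> G `<=` measurable ->
  measurable_wrt G f -> measurable_fun setT f.
Proof.
move=> sG Gm mf _ B mB.
have := mf measurableT B mB.
rewrite /measurable/= sigma_algebra_id//; exact: Gm.
Qed.

(** Approximate [H] from below by simple functions measurable for [G]. For a simple factor the
    integral is a finite sum of integrals of [X] or [Y] over sets of [G], where the two agree;
    monotone convergence then passes to [H]. *)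
Lemma ge0_integral_mull_eq (d : measure_display) (T : measurableType d)
    (R : realType) (mu : {measure set T -> \bar R}) (G : set (set T))
    (X Y H : T -> R) :
  sigma_algebra setT G -> G `<=` measurable ->
  measurable_fun setT X -> measurable_fun setT Y ->
  (forall w, 0 <= X w) -> (forall w, 0 <= Y w) ->
  measurable_wrt G H -> (forall w, 0 <= H w) ->
  (forall A, G A ->
    \int[mu]_(w in A) (X w)%:E = \int[mu]_(w in A) (Y w)%:E)%E ->
  forall A, G A ->
  (\int[mu]_(w in A) (H w * X w)%:E = \int[mu]_(w in A) (H w * Y w)%:E)%E.
Proof.
move=> sG Gm mX mY X0 Y0 mH H0 XY A GA.
have GE : G.-sigma.-measurable = G by exact: measurable_g_measurableTypeE.
(* The approximation is carried out on [g_sigma_algebraType G], so that the level sets of every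
   [h n] lie in [G] and not merely in the ambient sigma-algebra. *)
have mEH : @measurable_fun _ _ (g_sigma_algebraType G) (\bar R) setT
    (EFin \o H) by exact/measurable_EFinP.
pose h := nnsfun_approx measurableT mEH.
have mA : d.-measurable A by exact: Gm.
have mh n : measurable_fun [set: T] (h n : T -> R).
  by apply: (@measurable_wrtW _ _ _ G) => //; exact: measurable_funPT.
have hH w : (h n w)%:E @[n --> \oo] --> (H w)%:E.
  by apply: (@cvg_nnsfun_approx _ _ _ _ _ _ mEH) => // x _; rewrite lee_fin.
have Gh n r : G ((h n : T -> R) @^-1` [set r]).
  have : G.-sigma.-measurable ((h n : T -> R) @^-1` [set r]).
    exact: measurable_funPTI.
  by move: (_ @^-1` _) => B; rewrite GE.
have GI B : G B -> G (A `&` B).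
  by move: GA; rewrite -GE; exact: measurableI.
have simple (Z : T -> R) n : measurable_fun setT Z -> (forall w, 0 <= Z w) ->
    let s := fset_set (h n @` setT) in
    (\int[mu]_(w in A) (h n w * Z w)%:E =
     \sum_(i < #|`s|) (s`_i)%:E *
       \int[mu]_(w in A `&` ((h n : T -> R) @^-1` [set s`_i])) (Z w)%:E)%E.
  move=> mZ Z0 s.
  have s0 (i : 'I_#|`s|) : 0 <= s`_i.
    have : s`_i \in s by exact: mem_nth.
    by rewrite in_fset_set// => /set_mem[x _ <-].
  under eq_integral do rewrite fimfunEord mulr_suml -sumEFin.
  rewrite ge0_integral_sum//; last 2 first.
  - move=> i; apply/measurable_EFinP; apply: measurable_funM; last first.
      exact: measurable_funTS.
    apply: measurable_funM => //; apply: measurable_indic; exact/Gm/Gh.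
  - by move=> i w _; rewrite lee_fin !mulr_ge0.
  apply: eq_bigr => i _.
  under eq_integral do rewrite -mulrA EFinM.
  rewrite ge0_integralZl//; last 3 first.
  - apply/measurable_EFinP; apply: measurable_funM; last first.
      exact: measurable_funTS.
    apply: measurable_indic; exact/Gm/Gh.
  - by move=> w _; rewrite lee_fin mulr_ge0.
  - by rewrite lee_fin.
  congr (_ * _)%E.
  rewrite integral_mkcondr; apply: eq_integral => w _.
  by rewrite patchE indicE; case: ifPn => _; rewrite ?mul1r ?mul0r.
have cvgh (Z : T -> R) : measurable_fun setT Z -> (forall w, 0 <= Z w) ->
    (\int[mu]_(w in A) (h n w * Z w)%:E @[n --> \oo] -->
     \int[mu]_(w in A) (H w * Z w)%:E)%E.
  move=> mZ Z0.
  have -> : (\int[mu]_(w in A) (H w * Z w)%:E =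
      \int[mu]_(w in A) limn (fun n => (h n w * Z w)%:E))%E.
    apply: eq_integral => w _; apply/esym/cvg_lim => //.
    under eq_fun do rewrite EFinM; rewrite EFinM.
    by apply: cvgeZr.
  apply: cvg_monotone_convergence => //.
  - move=> n; apply/measurable_EFinP.
    by apply: measurable_funM; exact: measurable_funTS.
  - by move=> n w _; rewrite lee_fin mulr_ge0.
  - move=> w _ m n mn; rewrite lee_fin ler_wpM2r//.
    by have /lefP := nd_nnsfun_approx measurableT mEH mn; apply.
(* The approximating integrals for [X] and [Y] are equal for each [n], hence so are their limits. *)
apply: (@cvg_unique _ _ _ _ _ _ (cvgh X mX X0)) => //.
rewrite [X in X @ _](_ : _ = fun n => \int[mu]_(w in A) (h n w * Y w)%:E)%E.
  exact: cvgh.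
apply/funext => n; rewrite !simple//; apply: eq_bigr => i _.
by rewrite XY//; exact: GI.
Qed.

(** Serves with [K] the predictable part of a factor in the supermartingale, and with [K] constant
    for bounds and sign changes of conditional expectations. *)
Lemma is_cond_expectation_affine (d : measure_display) (T : measurableType d)
    (R : realType) (P : probability T R) (G : set (set T)) (X Y K : T -> R)
    (k : R) :
  sigma_algebra setT G -> G `<=` measurable ->
  P.-integrable setT (EFin \o X) -> is_cond_expectation P G X Y ->
  measurable_wrt G K -> P.-integrable setT (EFin \o K) ->
  is_cond_expectation P G (fun w => k * X w + K w) (fun w => k * Y w + K w).
Proof.
move=> sG Gm iX [mY iY XY] mK iK.
have ikZ (Z : T -> R) : P.-integrable setT (EFin \o Z) ->
    P.-integrable setT (EFin \o (fun w => k * Z w)).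
  by move=> iZ; exact: (integrableZl measurableT k iZ).
have intE (Z : T -> R) A : G A -> P.-integrable setT (EFin \o Z) ->
    (\int[P]_(w in A) (k * Z w + K w)%:E =
     k%:E * (\int[P]_(w in A) (Z w)%:E) + \int[P]_(w in A) (K w)%:E)%E.
  move=> /Gm mA iZ.
  have sub Z' : P.-integrable setT (EFin \o Z') -> P.-integrable A (EFin \o Z').
    by apply: integrableS.
  rewrite -(integralZl mA (sub _ iZ)) -integralD//; last 2 first.
  - exact: sub (ikZ _ iZ).
  - exact: sub.
split.
- apply: measurable_funD => //; exact: measurable_funM.
- exact: (integrableD measurableT (ikZ _ iY) iK).
- by move=> A GA; rewrite !intE// XY.
Qed.

Lemma integrable_ae_eq (d : measure_display) (T : measurableType d)
    (R : realType) (mu : {measure set T -> \bar R}) (f g : T -> R) :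
  measurable_fun setT g -> {ae mu, forall w, f w = g w} ->
  mu.-integrable setT (EFin \o f) -> mu.-integrable setT (EFin \o g).
Proof.
move=> mg fg /integrableP[mf]; have mEg : measurable_fun setT (EFin \o g).
  exact/measurable_EFinP.
rewrite (ae_eq_integral (abse \o (EFin \o g)))//.
- by move=> gfin; apply/integrableP.
- exact: measurableT_comp.
- exact: measurableT_comp.
- by apply: filterS fg => w /= ->.
Qed.

(** Used to pass to clamped versions. [G] may lack null sets, so an a.e. modification of a
    [G]-measurable function can fail to be [G]-measurable; hence the separate assumption on [Y']. *)
Lemma is_cond_expectation_ae (d : measure_display) (T : measurableType d)
    (R : realType) (P : probability T R) (G : set (set T))
    (X X' Y Y' : T -> R) :
  sigma_algebra setT G -> G `<=` measurable ->
  measurable_fun setT X -> measurable_fun setT X' -> measurable_wrt G Y' ->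
  {ae P, forall w, X w = X' w} -> {ae P, forall w, Y w = Y' w} ->
  is_cond_expectation P G X Y -> is_cond_expectation P G X' Y'.
Proof.
move=> sG Gm mX mX' mY' XX' YY' [mY iY XY].
have mYT : measurable_fun setT Y := measurable_wrtW sG Gm mY.
have mYT' : measurable_fun setT Y' := measurable_wrtW sG Gm mY'.
have E (Z Z' : T -> R) A : measurable A -> measurable_fun setT Z ->
    measurable_fun setT Z' -> {ae P, forall w, Z w = Z' w} ->
    (\int[P]_(w in A) (Z w)%:E = \int[P]_(w in A) (Z' w)%:E)%E.
  move=> mA mZ mZ' ZZ'; apply: ae_eq_integral => //.
  - apply/measurable_EFinP; exact: measurable_funTS.
  - apply/measurable_EFinP; exact: measurable_funTS.
  - by apply: filterS ZZ' => w -> _.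
split=> //.
- exact: (integrable_ae_eq mYT' YY' iY).
- by move=> A GA; have mA := Gm A GA; rewrite -(E X X')// -(E Y Y')// XY.
Qed.

(** The set [A] where [Y > 0] belongs to [G], so [Y] and [X] have the same integral over it. That
    integral is at most 0, which forces [Y = 0] a.e. on [A]: thus [A] is null. *)
Lemma cond_expectation_le0 (d : measure_display) (T : measurableType d)
    (R : realType) (P : probability T R) (G : set (set T)) (X Y : T -> R) :
  sigma_algebra setT G -> G `<=` measurable -> measurable_fun setT X ->
  {ae P, forall w, X w <= 0} -> is_cond_expectation P G X Y ->
  {ae P, forall w, Y w <= 0}.
Proof.
move=> sG Gm mX X0 [mY iY XY].
have mYT : measurable_fun setT Y := measurable_wrtW sG Gm mY.
pose A := Y @^-1` `]0, +oo[.
have GA : G A.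
  have := mY measurableT `]0, +oo[%classic (measurable_itv _).
  by rewrite setTI /measurable/= sigma_algebra_id.
have mA : measurable A := Gm _ GA.
have : (\int[P]_(w in A) `|(Y w)%:E| = 0)%E.
  apply/eqP; rewrite eq_le integral_ge0 ?andbT//.
  have -> : (\int[P]_(w in A) `|(Y w)%:E| = \int[P]_(w in A) (Y w)%:E)%E.
    apply: eq_integral => w /set_mem; rewrite /A/= in_itv/= andbT => Yw.
    by rewrite gtr0_norm.
  rewrite XY//.
  (* [X] is nonpositive only a.e.; replacing it by minus its negative part gives a sign at every
     point. *)
  have -> : (\int[P]_(w in A) (X w)%:E =
      \int[P]_(w in A) - (Num.max (- X w) 0)%:E)%E.
    apply: ae_eq_integral => //.
    - apply/measurable_EFinP; exact: measurable_funTS.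
    - apply: measurableT_comp => //; apply/measurable_EFinP.
      apply: measurable_maxr => //; apply: measurableT_comp => //.
      exact: measurable_funTS.
    - by apply: filterS X0 => w Xw _; rewrite max_l ?oppr_ge0// EFinN oppeK.
  have max0 w : A w -> (0 <= (Num.max (- X w) 0)%:E)%E.
    by move=> _; rewrite lee_fin le_max lexx orbT.
  by rewrite integral_ge0N// oppe_le0 integral_ge0.
move=> /(ae_eq_integral_abs P mA _).1 h.
have {h} : ae_eq P A (EFin \o Y) (cst 0%E).
  apply: h; apply/measurable_EFinP; exact: measurable_funTS.
apply: filterS => w h; rewrite leNgt; apply/negP => Yw.
have : A w by rewrite /A/= in_itv/= Yw.
by move=> /h[] Yw0; rewrite Yw0 ltxx in Yw.
Qed.

(** The pull-out property. Integrability of [H \* Y] is inherited from [H \* X]: both are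
    nonnegative and, [setT] being in [G], have the same total integral. *)
Lemma is_cond_expectation_mull (d : measure_display) (T : measurableType d)
    (R : realType) (P : probability T R) (G : set (set T)) (X Y H : T -> R) :
  sigma_algebra setT G -> G `<=` measurable -> measurable_fun setT X ->
  (forall w, 0 <= X w) -> (forall w, 0 <= Y w) -> (forall w, 0 <= H w) ->
  measurable_wrt G H -> P.-integrable setT (EFin \o (H \* X)) ->
  is_cond_expectation P G X Y ->
  is_cond_expectation P G (H \* X) (H \* Y).
Proof.
move=> sG Gm mX X0 Y0 H0 mH iHX [mY iY XY].
have mHY : measurable_wrt G (H \* Y) by exact: measurable_funM.
have mYT : measurable_fun setT Y := measurable_wrtW sG Gm mY.
have HXY A : G A ->
    (\int[P]_(w in A) (H w * X w)%:E = \int[P]_(w in A) (H w * Y w)%:E)%E.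
  apply: ge0_integral_mull_eq => //.
  by move=> B GB; rewrite XY.
split=> //; last by move=> A GA; rewrite HXY.
apply/integrableP; split.
  exact/measurable_EFinP/(measurable_wrtW sG Gm mHY).
case/integrableP : iHX => _.
have abs (Z : T -> R) : (forall w, 0 <= Z w) ->
    (\int[P]_w `|(H w * Z w)%:E| = \int[P]_w (H w * Z w)%:E)%E.
  by move=> Z0; apply: eq_integral => w _; rewrite gee0_abs// lee_fin mulr_ge0.
rewrite /= !abs// HXY//.
rewrite -(sigma_algebra_id sG).
exact: (@measurableT _ (g_sigma_algebraType G)).
Qed.

(** * The exponential supermartingale for pointwise bounded data *)

Lemma integrable_bounded (d : measure_display) (T : measurableType d)
    (R : realType) (P : probability T R) (f : T -> R) (a b : R) :
  measurable_fun setT f -> (forall w, a <= f w <= b) ->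
  P.-integrable setT (EFin \o f).
Proof.
move=> mf fab; apply: measurable_bounded_integrable => //.
  by rewrite (le_lt_trans (probability_le1 P measurableT)) ?ltry.
exists (`|a| + `|b|); split; first exact: num_real.
move=> r r_gt w _; have /andP[af fb] := fab w; rewrite /= ler_norml.
have := ler_norm (- a); rewrite normrN => na.
have := ler_norm b; have := normr_ge0 a; have := normr_ge0 b.
by move=> *; apply/andP; split; lra.
Qed.

Definition exp_process (R : realType) (T : Type) (l : R)
    (X Xhat C : nat -> T -> R) (t : nat) (w : T) : R :=
  \prod_(1 <= i < t.+1)
    ((1 + l * (X i w - Xhat i w)) * expR (- (l * (C i w - Xhat i w)))).

(** Each new factor is a [disc] known one step ahead times a [gain] affine in [X]. Conditioning
    replaces [X] by [C] in the gain, and [1 + y <= exp y] bounds the resulting factor by 1. All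
    bounds hold at every point, so each [L t] is bounded and hence integrable. *)
Lemma exp_process_supermartingale (d : measure_display)
    (T : measurableType d) (R : realType) (P : probability T R)
    (F : nat -> set (set T)) (a b l : R) (X Xhat C : nat -> T -> R) :
  filtration F -> 0 <= l -> l * (b - a) < 1 ->
  (forall t, (1 <= t)%N -> measurable_wrt (F t) (X t)) ->
  (forall t, (1 <= t)%N -> measurable_wrt (F t.-1) (Xhat t)) ->
  (forall t w, (1 <= t)%N -> a <= X t w <= b) ->
  (forall t w, (1 <= t)%N -> a <= Xhat t w <= b) ->
  (forall t w, (1 <= t)%N -> a <= C t w <= b) ->
  (forall t, (1 <= t)%N -> is_cond_expectation P (F t.-1) (X t) (C t)) ->
  supermartingale P F (exp_process l X Xhat C).
Proof.
move=> [sF Fm monoF] l0 lab mX mXh bX bXh bC XC.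
set L := exp_process l X Xhat C.
(* Written as [l * Z] plus a term measurable for [F t], the shape of [is_cond_expectation_affine];
   [Z] will be [X], then [C]. *)
pose gain (Z : nat -> T -> R) t w := l * Z t.+1 w + (1 - l * Xhat t.+1 w).
pose disc t w := expR (- (l * (C t.+1 w - Xhat t.+1 w))).
have LS t : L t.+1 = (L t \* disc t) \* gain X t.
  apply/funext => w; rewrite /L /exp_process big_nat_recr//= /gain /disc; ring.
have gain_bound Z t w : (forall t w, (1 <= t)%N -> a <= Z t w <= b) ->
    0 <= gain Z t w <= 1 + l * (b - a).
  move=> bZ; have /andP[Z1 Z2] := bZ t.+1 w isT.
  have /andP[H1 H2] := bXh t.+1 w isT.
  (* Nonnegativity comes from [Z - Xhat >= - (b - a)] and [l * (b - a) < 1]. *)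
  by rewrite /gain; apply/andP; split; nra.
have disc_bound t w : 0 <= disc t w <= expR (l * (b - a)).
  have /andP[Z1 Z2] := bC t.+1 w isT; have /andP[H1 H2] := bXh t.+1 w isT.
  by rewrite expR_ge0 ler_expR; nra.
have disc_gain t w : disc t w * gain C t w <= 1.
  rewrite /disc expRN ler_pdivrMl ?expR_gt0// mulr1.
  apply: le_trans (expR_ge1Dx _); rewrite /gain; lra.
have mC t : measurable_wrt (F t) (C t.+1) by have [] := XC t.+1 isT.
have mdisc t : measurable_wrt (F t) (disc t).
  apply: measurableT_comp => //; apply: measurable_funN.
  apply: measurable_funM => //; apply: measurable_funB.
  - exact: mC.
  - exact: (mXh t.+1 isT).
have mincr t : measurable_wrt (F t) (fun w => 1 - l * Xhat t.+1 w).
  apply: measurable_funB => //; apply: measurable_funM => //.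
  exact: (mXh t.+1 isT).
have mwS (f : T -> R) t : measurable_wrt (F t) f -> measurable_wrt (F t.+1) f.
  by apply: measurable_wrt_sub => //; exact: monoF.
have mL t : measurable_wrt (F t) (L t).
  elim: t => [|t IH].
    rewrite (_ : L 0%N = cst 1); first exact: measurable_cst.
    by apply/funext => w; rewrite /L /exp_process big_geq.
  rewrite LS; apply: measurable_funM.
    by apply: measurable_funM; exact: mwS.
  apply: measurable_funD; last exact: mwS.
  by apply: measurable_funM => //; exact: (mX t.+1 isT).
have bL t : exists M, forall w, 0 <= L t w <= M.
  elim: t => [|t [M IH]].
    by exists 1 => w; rewrite /L /exp_process big_geq// ler01 lexx.
  exists (M * expR (l * (b - a)) * (1 + l * (b - a))) => w; rewrite LS /=.
  have /andP[L0 LM] := IH w; have /andP[d0 dM] := disc_bound t w.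
  have /andP[g0 gM] := gain_bound X t w bX.
  by rewrite !mulr_ge0//= !ler_pM// mulr_ge0.
have iL t : P.-integrable setT (EFin \o L t).
  have [M LM] := bL t; apply: (@integrable_bounded _ _ _ _ _ 0 M) => //.
    exact: measurable_wrtW (sF t) (Fm t) (mL t).
split=> // t.
(* Pull out [L t \* disc t], then condition the affine gain. *)
exists ((L t \* disc t) \* gain C t).
  have mXT : measurable_fun setT (X t.+1).
    by apply: (measurable_wrtW (sF t.+1) (Fm t.+1)); exact: mX.
  have mXhT : measurable_fun setT (Xhat t.+1).
    by apply: (measurable_wrtW (sF t) (Fm t)); exact: (mXh t.+1 isT).
  have Ld0 w : 0 <= (L t \* disc t) w.
    have [M /(_ w)/andP[L0 _]] := bL t; have /andP[d0 _] := disc_bound t w.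
    exact: mulr_ge0.
  rewrite LS; apply: is_cond_expectation_mull => //.
  - apply: measurable_funD; first exact: measurable_funM.
    by apply: measurable_funB => //; exact: measurable_funM.
  - by move=> w; have /andP[] := gain_bound X t w bX.
  - by move=> w; have /andP[] := gain_bound C t w bC.
  - exact: (measurable_funM (mL t) (mdisc t)).
  - by have := iL t.+1; rewrite LS.
  apply: is_cond_expectation_affine => //.
  - by apply: (@integrable_bounded _ _ _ _ _ a b) => // w; exact: bX.
  - exact: (XC t.+1 isT).
  - apply: (@integrable_bounded _ _ _ _ _ (1 - l * b) (1 - l * a)) => [|w].
      by apply: measurable_funB => //; exact: measurable_funM.
    have /andP[H1 H2] := bXh t.+1 w isT.
    by apply/andP; split; nra.
apply/aeW => w /=; rewrite -mulrA ler_piMr//.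
by have [M /(_ w)/andP[]] := bL t.
Qed.

(** Rescaling of [fan_le], applied to [l * c] and [(x - h) / c]: the factor [c ^- 2] of [psiE] is
    absorbed by the square. Writing [x - m] as [(x - h) - (m - h)] splits off the last
    exponential. *)
Lemma expR_psiE_le (R : realType) (c l x h m : R) : 0 < c ->
  0 <= l -> l * c < 1 -> - c <= x - h ->
  expR (l * (x - m) - psiE c l * (x - h) ^+ 2) <=
  (1 + l * (x - h)) * expR (- (l * (m - h))).
Proof.
move=> c0 l0 lc xh.
have -> : l * (x - m) - psiE c l * (x - h) ^+ 2 =
    (l * c * ((x - h) / c) -
     (- ln (1 - l * c) - l * c) * ((x - h) / c) ^+ 2) - l * (m - h).
  by rewrite /psiE (mulrC c l); field; rewrite gt_eqF.
rewrite expRD ler_wpM2r ?expR_ge0//.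
have -> : 1 + l * (x - h) = 1 + l * c * ((x - h) / c).
  by field; rewrite gt_eqF.
apply: fan_le; first by rewrite mulr_ge0// ltW.
by rewrite ler_pdivlMr// mulN1r.
Qed.

(** * Clamping and almost sure bounds *)

Definition clamp (R : realType) (a b x : R) : R := Num.max a (Num.min x b).

Lemma clamp_bound (R : realType) (a b x : R) : a <= b -> a <= clamp a b x <= b.
Proof. by move=> ab; rewrite /clamp le_max lexx ge_max ab ge_min lexx orbT. Qed.

Lemma clamp_id (R : realType) (a b x : R) : a <= x <= b -> clamp a b x = x.
Proof. by move=> /andP[ax xb]; rewrite /clamp min_l// max_r. Qed.

Lemma measurable_wrt_clamp (d : measure_display) (T : measurableType d)
    (R : realType) (G : set (set T)) (a b : R) (f : T -> R) :
  measurable_wrt G f -> measurable_wrt G (clamp a b \o f).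
Proof. by move=> mf; apply: measurable_maxr => //; exact: measurable_minr. Qed.

Lemma integrable_ae_bounded (d : measure_display) (T : measurableType d)
    (R : realType) (P : probability T R) (f : T -> R) (a b : R) :
  a <= b -> measurable_fun setT f -> {ae P, forall w, a <= f w <= b} ->
  P.-integrable setT (EFin \o f).
Proof.
move=> ab mf fab; apply: (@integrable_ae_eq _ _ _ _ (clamp a b \o f)) => //.
  by apply: filterS fab => w /= /clamp_id.
apply: (@integrable_bounded _ _ _ _ _ a b) => [|w]; last exact: clamp_bound.
by apply: measurable_maxr => //; exact: measurable_minr.
Qed.

(** Apply [cond_expectation_le0] to the affine images [a - X] and [X - b]. *)
Lemma cond_expectation_bound (d : measure_display) (T : measurableType d)
    (R : realType) (P : probability T R) (G : set (set T)) (X Y : T -> R)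
    (a b : R) :
  sigma_algebra setT G -> G `<=` measurable ->
  P.-integrable setT (EFin \o X) -> {ae P, forall w, a <= X w <= b} ->
  is_cond_expectation P G X Y -> {ae P, forall w, a <= Y w <= b}.
Proof.
move=> sG Gm iX Xab XY.
have mX : measurable_fun setT X.
  by apply/measurable_EFinP; exact: measurable_int iX.
have upper (k r : R) : {ae P, forall w, k * X w + r <= 0} ->
    {ae P, forall w, k * Y w + r <= 0}.
  move=> Xr; apply: (cond_expectation_le0 sG Gm _ Xr).
    by apply: measurable_funD => //; exact: measurable_funM.
  apply: is_cond_expectation_affine => //; first exact: measurable_cst.
  exact: finite_measure_integrable_cst.
have Ya : {ae P, forall w, -1 * Y w + a <= 0}.
  by apply: upper; apply: filterS Xab => w /andP[? ?]; lra.
have Yb : {ae P, forall w, 1 * Y w + - b <= 0}.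
  by apply: upper; apply: filterS Xab => w /andP[? ?]; lra.
by apply: filterS2 Ya Yb => w ? ?; apply/andP; split; lra.
Qed.

Lemma is_cond_expectationN (d : measure_display) (T : measurableType d)
    (R : realType) (P : probability T R) (G : set (set T)) (X Y : T -> R) :
  sigma_algebra setT G -> G `<=` measurable ->
  P.-integrable setT (EFin \o X) -> is_cond_expectation P G X Y ->
  is_cond_expectation P G (fun w => - X w) (fun w => - Y w).
Proof.
move=> sG Gm iX XY.
have : is_cond_expectation P G (fun w => -1 * X w + 0) (fun w => -1 * Y w + 0).
  apply: is_cond_expectation_affine => //; first exact: measurable_cst.
  exact: finite_measure_integrable_cst.
under eq_fun do rewrite mulN1r addr0.
by under [X in _ _ X]eq_fun do rewrite mulN1r addr0.
Qed.

Lemma adapted_sum (d : measure_display) (T : measurableType d)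
    (R : realType) (F : nat -> set (set T)) (Y : nat -> T -> R) :
  filtration F -> (forall t, (1 <= t)%N -> measurable_wrt (F t) (Y t)) ->
  adapted F (fun t w => \sum_(1 <= i < t.+1) Y i w).
Proof.
move=> [sF _ monoF] mY; elim=> [|t IH].
  rewrite (_ : (fun w => _) = cst 0); first exact: measurable_cst.
  by apply/funext => w; rewrite big_geq.
rewrite (_ : (fun w => _) = (fun w => \sum_(1 <= i < t.+1) Y i w) \+ Y t.+1).
  apply: measurable_funD; last exact: mY.
  by apply: measurable_wrt_sub IH => //; exact: monoF.
by apply/funext => w; rewrite big_nat_recr.
Qed.

(** * The sub-exponential property of the centered sums *)

(** [sub_psi] asks for domination by the supermartingale only a.e., so the latter may be built from
    the clamped [Y] and [K], which agree a.e. with [X] and [C]. *)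
Lemma bounded_sub_psi (d : measure_display) (T : measurableType d)
    (R : realType) (P : probability T R) (F : nat -> set (set T)) (a b : R)
    (X Xhat C : nat -> T -> R) :
  a < b -> filtration F ->
  (forall t, (1 <= t)%N -> measurable_wrt (F t) (X t)) ->
  (forall t, (1 <= t)%N -> {ae P, forall w, a <= X t w <= b}) ->
  (forall t, (1 <= t)%N -> measurable_wrt (F t.-1) (Xhat t)) ->
  (forall t, (1 <= t)%N -> forall w, a <= Xhat t w <= b) ->
  (forall t, (1 <= t)%N -> is_cond_expectation P (F t.-1) (X t) (C t)) ->
  sub_psi P 1 ((b - a)^-1)%:E (psiE (b - a)) F
    (fun t w => \sum_(1 <= i < t.+1) (X i w - C i w))
    (fun t w => \sum_(1 <= i < t.+1) (X i w - Xhat i w) ^+ 2).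
Proof.
move=> ab filtF mX bX mXh bXh XC.
have [sF Fm monoF] := filtF.
have predW (f : T -> R) t : measurable_wrt (F t.-1) f -> measurable_wrt (F t) f.
  by apply: measurable_wrt_sub => //; apply: monoF; exact: leq_pred.
have mC t : (1 <= t)%N -> measurable_wrt (F t.-1) (C t) by move=> /XC[].
have clamp_ab := @clamp_bound R a b _ (ltW ab).
pose Y t := clamp a b \o X t.
pose K t := clamp a b \o C t.
have XY t : (1 <= t)%N -> {ae P, forall w, X t w = Y t w}.
  by move=> /bX; apply: filterS => w ?; rewrite /Y /= clamp_id.
have mXT t : (1 <= t)%N -> measurable_fun setT (X t).
  by move=> /mX; exact: measurable_wrtW.
have mYT t : (1 <= t)%N -> measurable_fun setT (Y t).
  by move=> /mX /(measurable_wrt_clamp a b); exact: measurable_wrtW.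
have iX t : (1 <= t)%N -> P.-integrable setT (EFin \o X t).
  by move=> t1; apply: integrable_ae_bounded (ltW ab) (mXT t t1) (bX t t1).
have bC t : (1 <= t)%N -> {ae P, forall w, a <= C t w <= b}.
  move=> t1; apply: cond_expectation_bound (bX t t1) (XC t t1) => //.
  exact: iX.
have CK t : (1 <= t)%N -> {ae P, forall w, C t w = K t w}.
  by move=> /bC; apply: filterS => w ?; rewrite /K /= clamp_id.
split.
- apply: adapted_sum => // t t1; apply: measurable_funB; first exact: mX.
  exact: (predW _ _ (mC t t1)).
- apply: adapted_sum => // t t1; apply: measurable_funX.
  by apply: measurable_funB; [exact: mX|exact: (predW _ _ (mXh t t1))].
- by move=> w; rewrite !big_geq.
- by move=> t w; apply: sumr_ge0 => i _; exact: sqr_ge0.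
move=> l l0; rewrite lte_fin => lab.
(* The range of [l] allowed by [lmax] is exactly the one in which Fan's inequality holds at scale
   [b - a]. *)
have lab1 : l * (b - a) < 1 by rewrite -ltr_pdivlMr ?subr_gt0// div1r.
exists (exp_process l Y Xhat K); split.
- apply: (@exp_process_supermartingale _ _ _ _ _ a b) => //.
  + by move=> t /mX; exact: measurable_wrt_clamp.
  + by move=> t w _; exact: clamp_ab.
  + by move=> t w t1; exact: bXh.
  + by move=> t w _; exact: clamp_ab.
  + move=> t t1; apply: is_cond_expectation_ae (XC t t1) => //.
    * exact: mXT.
    * exact: mYT.
    * by apply: measurable_wrt_clamp; exact: mC.
    * exact: XY.
    * exact: CK.
(* At time 0 the product is empty, whence [l0 = 1]. *)
- rewrite (_ : exp_process _ _ _ _ _ = cst 1); first by rewrite expectation_cst.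
  by apply/funext => w; rewrite /exp_process big_geq.
move=> t.
(* A countable union of null sets is null, so one exceptional set serves all indices; outside it the
   comparison is made factor by factor. *)
have : {ae P, forall w, forall i, (1 <= i)%N -> X i w = Y i w /\ C i w = K i w}.
  apply: ae_foralln => i; have [i1|i0] := leqP 1 i; last exact: aeW.
  by apply: filterS2 (XY i i1) (CK i i1) => w -> ->.
apply: filterS => w XCYK.
rewrite !mulr_sumr -sumrB expR_sum /exp_process.
rewrite !big_nat; apply: ler_prod => i /andP[i1 _].
have [-> ->] := XCYK i i1.
rewrite expR_ge0/=; apply: expR_psiE_le => //; first by rewrite subr_gt0.
have /andP[Y1 Y2] := clamp_ab (X i w); have /andP[h1 h2] := bXh i i1 w.
rewrite /Y/=; lra.
Qed.

(** * Union bound over the two tails *)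

(** As [u] is arbitrary, the crossing events may be nonmeasurable; the union bound rests on
    monotonicity and subadditivity of the outer measure. *)
Lemma le_outer_probabilityU (d : measure_display) (T : measurableType d)
    (R : realType) (P : probability T R) (A B C : set T) : A `<=` B `|` C ->
  (outer_probability P A <= outer_probability P B + outer_probability P C)%E.
Proof.
move=> ABC; apply: le_trans (le_mu_ext P ABC) _.
exact: outer_measureU2.
Qed.

Theorem theorem4 (R : realType) (d : measure_display) (T : measurableType d)
  (P : probability T R) (F : nat -> set (set T))
  (a b : R) (X Xhat condX : nat -> T -> R) (alpha : R) (u : R -> R)
  (ltab : a < b)
  (filtF : filtration F)
  (adaptedX : forall t, (1 <= t)%N -> measurable_wrt (F t) (X t))
  (boundedX : forall t, (1 <= t)%N -> {ae P, forall w, a <= X t w <= b})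
  (predXhat : forall t, (1 <= t)%N -> measurable_wrt (F t.-1) (Xhat t))
  (boundedXhat : forall t, (1 <= t)%N -> forall w, a <= Xhat t w <= b)
  (condXE : forall t, (1 <= t)%N ->
     is_cond_expectation P (F t.-1) (X t) (condX t))
  (alpha01 : 0 < alpha < 1)
  (ubound : sub_exponential_uniform_boundary (b - a) alpha u) :
  ((1 - 2 * alpha)%:E <=
   inner_probability P
     [set w | forall t, (1 <= t)%N ->
        (`|running_mean X t w - running_mean condX t w| <
         u (\sum_(1 <= i < t.+1) (X i w - Xhat i w) ^+ 2) / t%:R)%R])%E.
Proof.
have [sF Fm _] := filtF.
pose S t w := \sum_(1 <= i < t.+1) (X i w - condX i w).
(* The processes attached to [-X], [-Xhat] and [-condX], kept in the literal form produced by
   [bounded_sub_psi]. *)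
pose S' t w := \sum_(1 <= i < t.+1) (- X i w - - condX i w).
pose V t w := \sum_(1 <= i < t.+1) (X i w - Xhat i w) ^+ 2.
pose V' t w := \sum_(1 <= i < t.+1) (- X i w - - Xhat i w) ^+ 2.
have S'E t w : S' t w = - S t w.
  by rewrite /S' /S -sumrN; apply: eq_bigr => i _; rewrite opprD.
have V'E t w : V' t w = V t w.
  by apply: eq_bigr => i _; rewrite -opprD sqrrN.
have iX t : (1 <= t)%N -> P.-integrable setT (EFin \o X t).
  move=> t1; apply: integrable_ae_bounded (ltW ltab) _ (boundedX t t1).
  exact: measurable_wrtW (adaptedX t t1).
have up := ubound _ _ P F S V filtF
  (bounded_sub_psi ltab filtF adaptedX boundedX predXhat boundedXhat condXE).
have dn : (outer_probability P
    [set w | exists2 t, (1 <= t)%N & (u (V' t w) <= S' t w)%R] <= alpha%:E)%E.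
  apply: (ubound _ _ P F S' V' filtF).
  (* The reflected interval [[-b, -a]] has the same length, so the same boundary [u] applies. *)
  rewrite (_ : b - a = - a - - b); last by rewrite opprK addrC.
  apply: (@bounded_sub_psi _ _ _ _ _ (- b) (- a) (fun t w => - X t w)
    (fun t w => - Xhat t w) (fun t w => - condX t w)) => //.
  - by rewrite ltrN2.
  - by move=> t t1; apply: measurable_funN; exact: adaptedX.
  - move=> t t1; apply: filterS (boundedX t t1) => w /andP[aX Xb].
    by rewrite !lerN2 Xb.
  - by move=> t t1; apply: measurable_funN; exact: predXhat.
  - move=> t t1 w; have /andP[aX Xb] := boundedXhat t t1 w.
    by rewrite !lerN2 Xb.
  - by move=> t t1; apply: is_cond_expectationN => //;
      [exact: iX|exact: condXE].
rewrite /inner_probability.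
have : (outer_probability P (~` [set w | forall t, (1 <= t)%N ->
    (`|running_mean X t w - running_mean condX t w| <
     u (\sum_(1 <= i < t.+1) (X i w - Xhat i w) ^+ 2) / t%:R)%R]) <=
    alpha%:E + alpha%:E)%E.
  (* Failure at some [t >= 1] means, after multiplying by [t], that [u (V t w)] is at most the
     absolute value of [S t w]: either [S] or [-S] crosses the boundary. *)
  apply: le_trans (leeD up dn); apply: le_outer_probabilityU => w /=.
  move/existsNP => [t /not_implyP[t1 /negP]].
  rewrite -leNgt /running_mean -mulrBr -sumrB.
  have t0 : 0 < t%:R^-1 :> R by rewrite invr_gt0 ltr0n.
  rewrite normrM gtr0_norm// mulrC ler_pM2l//.
  rewrite ler_normr => /orP[uS|uS]; [left|right]; exists t => //.
  by rewrite V'E S'E.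
move=> h; rewrite -EFinD -mulr2n in h.
apply: (@le_trans _ _ (1 - (alpha *+ 2)%:E)%E).
  by rewrite -EFinB mulr_natl.
exact: leeB.
Qed.
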